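(* Let $V$ be a smooth scheme over a field, let $\mathcal{G}=\bigoplus_n I_nW^n$ be a Rees algebra over $V$, let $x\in\mathrm{Sing}(\mathcal{G})$, and suppose that locally at $x$, $\mathcal{G}=\mathcal{O}_{V,x}[f_1W^{n_1},\dots,f_sW^{n_s}]$ with all $n_i\ge1$. Let $N>0$ be an integer which is a common multiple of all $n_i$, $i=1,\dots,s$, and let $\mathcal{G}_N=\mathcal{O}_V[I_NW^N]$ be the Rees ring attached to $I_N$. Then: 1. $\mathbb{I}_{\mathcal{G}_N,x}=\langle \mathrm{In}_N(I_N)\rangle$. 2. $\sqrt{\mathbb{I}_{\mathcal{G}_N,x}}=\sqrt{\langle \mathrm{In}_N(I_N)\rangle}=\sqrt{\mathbb{I}_{\mathcal{G},x}}$.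
   Context: A Rees algebra over a smooth scheme $V$ is a graded subalgebra $\mathcal{G}=\bigoplus_{n\ge 0} I_nW^n$ of $\mathcal{O}_V[W]$ ($W$ a dummy variable), where the $I_n$ are sheaves of ideals with $I_0=\mathcal{O}_V$ and $I_sI_t\subset I_{s+t}$, which is locally a finitely generated $\mathcal{O}_V$-algebra. The singular locus is $\mathrm{Sing}(\mathcal{G})=\{x\in V : \nu_x(I_n)\ge n \text{ for all } n\ge 1\}$, with $\nu_x(I_n)$ the order of $I_n$ at $\mathcal{O}_{V,x}$. $\mathcal{G}_N=\mathcal{O}_V[I_NW^N]$ is the subalgebra of $\mathcal{O}_V[W]$ generated by $I_NW^N$, whose component of degree $mN$ is $I_N^m W^{mN}$ and whose components in degrees not divisible by $N$ are zero. Let $\mathfrak{M}_x$ be the maximal ideal of $\mathcal{O}_{V,x}$. For an ideal $J\subset\mathfrak{M}_x^n$, $\mathrm{In}_n(J)$ denotes the image of $J$ in $\mathfrak{M}_x^n/\mathfrak{M}_x^{n+1}$. For a Rees algebra $\mathcal{H}=\bigoplus J_nW^n$ with $x\in\mathrm{Sing}(\mathcal{H})$, $\mathbb{I}_{\mathcal{H},x}$ is the homogeneous ideal of $gr_{\mathfrak{M}_x}(\mathcal{O}_{V,x})$ generated by all $\mathrm{In}_n(J_n)$, $n\ge1$. *)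

(* Defs.v *)
From HB Require Import structures.
From mathcomp Require Import all_boot all_algebra.
From mathcomp Require Import boolp classical_sets topology.

Set Implicit Arguments.
Unset Strict Implicit.
Unset Printing Implicit Defensive.

Import GRing.Theory.
Local Open Scope ring_scope.
Local Open Scope classical_set_scope.
Local Open Scope quotient_scope.

Section Ideals.
Variable R : comPzRingType.
Implicit Types I J S : set R.

(* The ideals of ring_quotient (idealr) are proper; the unit ideal is needed
   here. *)
Definition is_ideal I : Prop :=
  [/\ I 0, (forall a b, I a -> I b -> I (a + b))
    & (forall a b, I b -> I (a * b))].

Definition is_prime I : Prop :=
  [/\ is_ideal I, ~ I 1 & forall a b, I (a * b) -> I a \/ I b].

Definition ideal_gen S : set R := smallest is_ideal S.

Definition ideal_mul I J : set R := ideal_gen [set a * b | a in I & b in J].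

Definition ideal_exp I (n : nat) : set R := iter n (ideal_mul I) setT.

Definition radical I : set R := [set a | exists n : nat, I (a ^+ n)].

Definition is_unit (a : R) : Prop := exists b, a * b = 1.

Definition nonunits : set R := [set a | ~ is_unit a].

Definition is_local : Prop := (1 : R) <> 0 /\ is_ideal nonunits.

End Ideals.

Arguments nonunits : clear implicits.
Arguments is_local : clear implicits.

Section IdealFacts.
Variable R : comPzRingType.
Implicit Types I J S : set R.

Lemma ideal_gen_ideal S : is_ideal (ideal_gen S).
Proof.
split.
- by move=> I [[]].
- by move=> a b Sa Sb I SI; case: (SI) => -[_ D _] _; apply: D; [exact: Sa|exact: Sb].
- by move=> a b Sb I SI; case: (SI) => -[_ _ M] _; apply: M; exact: Sb.
Qed.

Lemma ideal_gen_sub S : S `<=` ideal_gen S.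
Proof. by move=> a Sa I [_]; apply. Qed.

Lemma ideal_gen_min S I : is_ideal I -> S `<=` I -> ideal_gen S `<=` I.
Proof. by move=> iI SI a; apply. Qed.

Lemma idealN I a : is_ideal I -> I a -> I (- a).
Proof. by case=> _ _ M Ia; rewrite -mulN1r; apply: M. Qed.

Lemma ideal_sum I (T : Type) (r : seq T) (F : T -> R) :
  is_ideal I -> (forall i, I (F i)) -> I (\sum_(i <- r) F i).
Proof.
by case=> I0 D _ IF; elim/big_ind: _ => // a b; exact: D.
Qed.

Lemma setT_ideal : is_ideal [set: R].
Proof. by []. Qed.

Lemma ideal_exp_ideal I n : is_ideal (ideal_exp I n).
Proof. by case: n => [|n] //; exact: ideal_gen_ideal. Qed.

Lemma ideal_expM I m n a b :
  ideal_exp I m a -> ideal_exp I n b -> ideal_exp I (m + n) (a * b).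
Proof.
elim: m a b => [|m IHm] a b.
  by move=> _ Ib; case: (ideal_exp_ideal I n) => _ _; apply.
move=> Ia Ib.
pose K := [set c | ideal_exp I (m.+1 + n) (c * b)].
have [i0 iD iM] := ideal_exp_ideal I (m.+1 + n).
have iK : is_ideal K.
  split; rewrite /K /=.
  - by rewrite mul0r.
  - by move=> c d Kc Kd; rewrite mulrDl; apply: iD.
  - by move=> c d Kd; rewrite -mulrA; apply: iM.
apply: (ideal_gen_min iK _ Ia) => _ [c Ic [d Id <-]].
rewrite /K /= -mulrA; apply: ideal_gen_sub; exists c => //.
by exists (d * b) => //; apply: IHm.
Qed.

End IdealFacts.

Lemma ideal_exp_morph (A B : comPzRingType) (f : {rmorphism A -> B})
    (I : set A) (J : set B) n :
  (forall a, I a -> J (f a)) -> forall a, ideal_exp I n a -> ideal_exp J n (f a).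
Proof.
move=> fIJ; elim: n => [|n IHn] // a.
have [i0 iD iM] := ideal_exp_ideal J n.+1.
apply: (@ideal_gen_min _ _ [set a | ideal_exp J n.+1 (f a)]).
  split=> /=; first by rewrite rmorph0.
    by move=> c d Kc Kd; rewrite rmorphD; apply: iD.
  by move=> c d Kd; rewrite rmorphM; apply: iM.
move=> _ [c Ic [d Id <-]] /=; rewrite rmorphM; apply: ideal_gen_sub.
by exists (f c); [exact: fIJ | exists (f d) => //; exact: IHn].
Qed.

Record localRing := LocalRing {
  local_sort :> comNzRingType;
  localP : is_local local_sort
}.

Definition max_ideal (R : localRing) : set R := nonunits R.

Arguments max_ideal : clear implicits.

(* The order of J is the supremum of the n such that J is contained in M^n,
   M the maximal ideal.  As the powers of M decrease, the order is at least n
   if and only if J is contained in M^n, which is how it is written here. *)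
Definition order_ge (R : localRing) (J : set R) (n : nat) : Prop :=
  J `<=` ideal_exp (max_ideal R) n.

(* gr_M(R) = (+)_n M^n / M^(n+1), realized as the quotient of the subring
   (+)_n M^n X^n of R[X] by the ideal (+)_n M^(n+1) X^n. *)
Section AssociatedGraded.
Variable R : localRing.
Local Notation M := (max_ideal R).

Definition blowup_pred : {pred {poly R}} :=
  fun p => `[< forall n, ideal_exp M n p`_n >].

Lemma blowup_subring : subring_closed blowup_pred.
Proof.
split.
- apply/asboolP=> -[|n]; first by [].
  by rewrite coef1; case: (ideal_exp_ideal M n.+1).
- move=> p q /asboolP Mp /asboolP Mq; apply/asboolP=> n.
  have iM := ideal_exp_ideal M n.
  by rewrite coefB; case: (iM) => _ D _; apply: D => //; exact: idealN.
- move=> p q /asboolP Mp /asboolP Mq; apply/asboolP=> n.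
  rewrite coefM; apply: (ideal_sum _ (ideal_exp_ideal M n)) => i.
  have le_in : (i <= n)%N by rewrite -ltnS.
  by rewrite -[X in ideal_exp _ X](subnKC le_in); exact: ideal_expM.
Qed.

HB.instance Definition _ :=
  GRing.isSubringClosed.Build {poly R} blowup_pred blowup_subring.

Record blowup_ring := BlowupRing {
  blowup_val :> {poly R};
  blowupP : blowup_val \in blowup_pred
}.

HB.instance Definition _ := [isSub for blowup_val].
HB.instance Definition _ := [Choice of blowup_ring by <:].
HB.instance Definition _ := [SubChoice_isSubComNzRing of blowup_ring by <:].

Definition gr_ideal : {pred blowup_ring} :=
  fun p => `[< forall n, ideal_exp M n.+1 (blowup_val p)`_n >].

Lemma gr_ideal_closed : idealr_closed gr_ideal.
Proof.
split.
- apply/asboolP=> n; rewrite (_ : blowup_val 0 = 0) ?coef0; last by [].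
  by case: (ideal_exp_ideal M n.+1).
- apply/asboolP=> /(_ 0%N) /=; rewrite coef1 /=.
  suff sM : ideal_exp M 1 `<=` M by move=> /sM; apply; exists 1; rewrite mulr1.
  have [_ iM] := localP R.
  apply: ideal_gen_min => // _ [a Ma [b _ <-]].
  by rewrite mulrC; case: iM => _ _; apply.
- move=> p q r /asboolP Mq /asboolP Mr; apply/asboolP=> n.
  rewrite (_ : blowup_val _ = blowup_val p * blowup_val q + blowup_val r) //.
  rewrite coefD coefM.
  have iM := ideal_exp_ideal M n.+1.
  case: (iM) => _ D _; apply: (D _ _ _ (Mr n)).
  apply: (ideal_sum _ iM) => i; have le_in : (i <= n)%N by rewrite -ltnS.
  rewrite -[X in ideal_exp _ X.+1](subnKC le_in) -addnS.
  by apply: ideal_expM => //; move/asboolP: (blowupP p); apply.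
Qed.

HB.instance Definition _ := isIdealr.Build blowup_ring gr_ideal gr_ideal_closed.

Definition gr : comNzRingType := {ideal_quot gr_ideal}.

(* The image of J in M^n/M^(n+1), the degree n part of gr; meant for J contained
   in M^n (elements of J outside M^n contribute nothing). *)
Definition initial_forms (n : nat) (J : set R) : set gr :=
  [set (\pi_gr p) | p in [set p : blowup_ring |
     exists2 a, J a & blowup_val p = a *: 'X^n]].

End AssociatedGraded.

Identity Coercion set_fun : set >-> Funclass.

Section OpenSets.
Variable X : topologicalType.

Record opens := Opens { open_set :> set X; open_setP : open open_set }.

Definition opensI (U W : opens) : opens :=
  Opens (openI (open_setP U) (open_setP W)).

Lemma opensIl U W : opensI U W `<=` U. Proof. by move=> y []. Qed.

Lemma opensIr U W : opensI U W `<=` W. Proof. by move=> y []. Qed.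

Definition opensT : opens := Opens (@openT X).

End OpenSets.

Record ringedSpace := RingedSpace {
  space :> topologicalType;
  sect : opens space -> comPzRingType;
  res : forall U W : opens space, W `<=` U -> {rmorphism sect U -> sect W};
  res_id : forall (U : opens space) (h : U `<=` U) s, res h s = s;
  res_comp : forall (U W Z : opens space) (hWU : W `<=` U) (hZW : Z `<=` W)
    (hZU : Z `<=` U) s, res hZW (res hWU s) = res hZU s;
  sect_sep : forall (U : opens space) (I : Type) (C : I -> opens space)
    (hC : forall i, C i `<=` U), U `<=` \bigcup_i C i ->
    forall s t, (forall i, res (hC i) s = res (hC i) t) -> s = t;
  sect_glue : forall (U : opens space) (I : Type) (C : I -> opens space)
    (hC : forall i, C i `<=` U), U `<=` \bigcup_i C i ->
    forall s : (forall i, sect (C i)),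
      (forall i j (W : opens space) (hi : W `<=` C i) (hj : W `<=` C j),
         res hi (s i) = res hj (s j)) ->
      exists t, forall i, res (hC i) t = s i
}.

Section Stalk.
Variables (X : ringedSpace) (x : X).

Record pregerm := Pregerm {
  pg_open : opens X;
  pg_in : pg_open x;
  pg_sect : sect pg_open
}.

HB.instance Definition _ := gen_eqMixin pregerm.
HB.instance Definition _ := gen_choiceMixin pregerm.

Definition germ_eq (a b : pregerm) : bool :=
  `[< exists (W : opens X) (ha : W `<=` pg_open a) (hb : W `<=` pg_open b),
        W x /\ res ha (pg_sect a) = res hb (pg_sect b) >].

Lemma germ_eq_equiv : equiv_class_of germ_eq.
Proof.
split=> [a|a b|b a c].
- by apply/asboolP; exists (pg_open a), (fun _ h => h), (fun _ h => h); split=> //; exact: pg_in.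
- by apply/asboolP/asboolP => -[W [ha [hb [Wx e]]]]; exists W, hb, ha.
- move=> /asboolP[W [ha [hb [Wx e]]]] /asboolP[Z [hb' [hc [Zx e']]]].
  apply/asboolP.
  have hW : opensI W Z `<=` W by move=> ? [].
  have hZ : opensI W Z `<=` Z by move=> ? [].
  exists (opensI W Z), (subset_trans hW ha), (subset_trans hZ hc); split=> //.
  rewrite -(res_comp ha hW) e -(res_comp hc hZ) -e'.
  by rewrite !(res_comp _ _ (subset_trans hW hb)).
Qed.

Canonical germ_eq_rel := EquivRelPack germ_eq_equiv.

Definition stalk := {eq_quot germ_eq}.

HB.instance Definition _ := Choice.on stalk.

Definition germ (U : opens X) (Ux : U x) (s : sect U) : stalk :=
  \pi_stalk (Pregerm Ux s).

Lemma germP (U W : opens X) (Ux : U x) (Wx : W x) (s : sect U) (t : sect W) :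
  germ Ux s = germ Wx t <->
  exists (Z : opens X) (hU : Z `<=` U) (hW : Z `<=` W),
    Z x /\ res hU s = res hW t.
Proof.
by split=> [/eqmodP/asboolP|e]; last apply/eqmodP/asboolP.
Qed.

Lemma germ_res (U W : opens X) (Ux : U x) (Wx : W x) (h : W `<=` U) s :
  germ Wx (res h s) = germ Ux s.
Proof.
apply/germP; exists W, (fun _ k => k), h; split=> //.
by rewrite res_id.
Qed.

Lemma stalkP (a : stalk) : exists (U : opens X) (Ux : U x) s, a = germ Ux s.
Proof. by rewrite -[a]reprK; case: (repr a) => U Ux s; exists U, Ux, s. Qed.

Lemma stalkP2 (a b : stalk) :
  exists (U : opens X) (Ux : U x) s t, a = germ Ux s /\ b = germ Ux t.
Proof.
have [U [Ux [s ->]]] := stalkP a; have [W [Wx [t ->]]] := stalkP b.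
have hU : opensI U W `<=` U by move=> ? [].
have hW : opensI U W `<=` W by move=> ? [].
have Zx : opensI U W x by [].
by exists (opensI U W), Zx, (res hU s), (res hW t); rewrite !germ_res.
Qed.

Lemma stalkP3 (a b c : stalk) :
  exists (U : opens X) (Ux : U x) s t u,
    [/\ a = germ Ux s, b = germ Ux t & c = germ Ux u].
Proof.
have [U [Ux [s [t [-> ->]]]]] := stalkP2 a b.
have [W [Wx [u ->]]] := stalkP c.
have hU : opensI U W `<=` U by move=> ? [].
have hW : opensI U W `<=` W by move=> ? [].
have Zx : opensI U W x by [].
by exists (opensI U W), Zx, (res hU s), (res hU t), (res hW u); rewrite !germ_res.
Qed.

Definition stalk_op1 (op : forall U : opens X, sect U -> sect U) (a : stalk) :
    stalk :=
  germ (pg_in (repr a)) (op _ (pg_sect (repr a))).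

Definition stalk_op2 (op : forall U : opens X, sect U -> sect U -> sect U)
    (a b : stalk) : stalk :=
  @germ (opensI (pg_open (repr a)) (pg_open (repr b)))
    (conj (pg_in (repr a)) (pg_in (repr b)))
    (op _ (res (@opensIl _ _ _) (pg_sect (repr a)))
          (res (@opensIr _ _ _) (pg_sect (repr b)))).

Lemma stalk_op1E op (U : opens X) (Ux : U x) s :
  (forall (U W : opens X) (h : W `<=` U) s, res h (op U s) = op W (res h s)) ->
  stalk_op1 op (germ Ux s) = germ Ux (op _ s).
Proof.
move=> op_res; rewrite /stalk_op1.
have : germ (pg_in (repr (germ Ux s))) (pg_sect (repr (germ Ux s))) = germ Ux s.
  by rewrite -[RHS]reprK; case: (repr _).
move: (pg_in _) (pg_sect _) => Wx t /germP[Z [hU [hW [Zx e]]]].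
by apply/germP; exists Z, hU, hW; rewrite !op_res e.
Qed.

Lemma stalk_op2E op (U : opens X) (Ux : U x) s t :
  (forall (U W : opens X) (h : W `<=` U) s t,
     res h (op U s t) = op W (res h s) (res h t)) ->
  stalk_op2 op (germ Ux s) (germ Ux t) = germ Ux (op _ s t).
Proof.
move=> op_res; rewrite /stalk_op2.
have reprE a : germ (pg_in (repr a)) (pg_sect (repr a)) = a.
  by rewrite -[RHS]reprK; case: (repr _).
move: (reprE (germ Ux s)) (reprE (germ Ux t)).
case: (repr (germ Ux s)) => /= U1 U1x s1; case: (repr (germ Ux t)) => /= U2 U2x s2.
move=> /germP[Z [hU1 [hU [Zx e]]]] /germP[W [hU2 [hU' [Wx e']]]].
apply/germP.
have hZ : opensI Z W `<=` Z by move=> ? [].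
have hW : opensI Z W `<=` W by move=> ? [].
have h12 : opensI Z W `<=` opensI U1 U2.
  by move=> y [Zy Wy]; split; [exact (hU1 _ Zy)|exact (hU2 _ Wy)].
exists (opensI Z W), h12, (subset_trans hZ hU); split; first by [].
rewrite !op_res !(res_comp _ _ (subset_trans hZ hU1)).
rewrite !(res_comp _ _ (subset_trans hW hU2)).
rewrite -(res_comp hU1 hZ) e (res_comp _ _ (subset_trans hZ hU)).
rewrite -(res_comp hU2 hW) e' (res_comp _ _ (subset_trans hW hU')).
by rewrite (Prop_irrelevance (subset_trans hW hU') (subset_trans hZ hU)).
Qed.

Let one_in : opensT X x. Proof. by []. Qed.

Definition stalk0 : stalk := germ one_in 0.
Definition stalk1 : stalk := germ one_in 1.
Definition stalkN := stalk_op1 (fun U => @GRing.opp (sect U)).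
Definition stalkD := stalk_op2 (fun U => @GRing.add (sect U)).
Definition stalkM := stalk_op2 (fun U => @GRing.mul (sect U)).

Lemma germ_stalk0 (U : opens X) (Ux : U x) : stalk0 = germ Ux 0.
Proof.
pose h : U `<=` opensT X := @subsetT _ _.
by rewrite -(rmorph0 (res h)) (germ_res one_in).
Qed.

Lemma germ_stalk1 (U : opens X) (Ux : U x) : stalk1 = germ Ux 1.
Proof.
pose h : U `<=` opensT X := @subsetT _ _.
by rewrite -(rmorph1 (res h)) (germ_res one_in).
Qed.

Lemma germ_stalkN (U : opens X) (Ux : U x) s : stalkN (germ Ux s) = germ Ux (- s).
Proof. by apply: stalk_op1E => *; rewrite rmorphN. Qed.

Lemma germ_stalkD (U : opens X) (Ux : U x) s t :
  stalkD (germ Ux s) (germ Ux t) = germ Ux (s + t).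
Proof. by apply: stalk_op2E => *; rewrite rmorphD. Qed.

Lemma germ_stalkM (U : opens X) (Ux : U x) s t :
  stalkM (germ Ux s) (germ Ux t) = germ Ux (s * t).
Proof. by apply: stalk_op2E => *; rewrite rmorphM. Qed.

Lemma stalkDA : associative stalkD.
Proof.
move=> a b c; have [U [Ux [s [t [u [-> -> ->]]]]]] := stalkP3 a b c.
by rewrite !germ_stalkD addrA.
Qed.

Lemma stalkDC : commutative stalkD.
Proof.
move=> a b; have [U [Ux [s [t [-> ->]]]]] := stalkP2 a b.
by rewrite !germ_stalkD addrC.
Qed.

Lemma stalk0D : left_id stalk0 stalkD.
Proof.
move=> a; have [U [Ux [s ->]]] := stalkP a.
by rewrite (germ_stalk0 Ux) germ_stalkD add0r.
Qed.

Lemma stalkND : left_inverse stalk0 stalkN stalkD.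
Proof.
move=> a; have [U [Ux [s ->]]] := stalkP a.
by rewrite (germ_stalk0 Ux) germ_stalkN germ_stalkD addNr.
Qed.

HB.instance Definition _ :=
  GRing.isZmodule.Build stalk stalkDA stalkDC stalk0D stalkND.

Lemma stalkMA : associative stalkM.
Proof.
move=> a b c; have [U [Ux [s [t [u [-> -> ->]]]]]] := stalkP3 a b c.
by rewrite !germ_stalkM mulrA.
Qed.

Lemma stalkMC : commutative stalkM.
Proof.
move=> a b; have [U [Ux [s [t [-> ->]]]]] := stalkP2 a b.
by rewrite !germ_stalkM mulrC.
Qed.

Lemma stalk1M : left_id stalk1 stalkM.
Proof.
move=> a; have [U [Ux [s ->]]] := stalkP a.
by rewrite (germ_stalk1 Ux) germ_stalkM mul1r.
Qed.

Lemma stalkMDl : left_distributive stalkM stalkD.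
Proof.
move=> a b c; have [U [Ux [s [t [u [-> -> ->]]]]]] := stalkP3 a b c.
by rewrite !(germ_stalkM, germ_stalkD) mulrDl.
Qed.

HB.instance Definition _ :=
  GRing.Zmodule_isComPzRing.Build stalk stalkMA stalkMC stalk1M stalkMDl.

Lemma germD (U : opens X) (Ux : U x) s t :
  germ Ux (s + t) = germ Ux s + germ Ux t.
Proof. by rewrite -germ_stalkD. Qed.

Lemma germM (U : opens X) (Ux : U x) s t :
  germ Ux (s * t) = germ Ux s * germ Ux t.
Proof. by rewrite -germ_stalkM. Qed.

Lemma germ1 (U : opens X) (Ux : U x) : germ Ux 1 = 1.
Proof. by rewrite -germ_stalk1. Qed.

Lemma germ0 (U : opens X) (Ux : U x) : germ Ux 0 = 0.
Proof. by rewrite -germ_stalk0. Qed.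

End Stalk.

(* f : A -> B is the localization of A at the powers of a. *)
Definition is_localization (A B : comPzRingType) (a : A) (f : {rmorphism A -> B}) :
    Prop :=
  [/\ is_unit (f a),
      (forall b, exists (n : nat) c, b * f a ^+ n = f c)
    & (forall c, f c = 0 -> exists n : nat, a ^+ n * c = 0)].

(* (U, O_U) is isomorphic to Spec A for A = O(U): h is a homeomorphism from U
   to Spec A for the Zariski topology, and on each D(a) the sections are A_a. *)
Definition affine (X : ringedSpace) (U : opens X) : Prop :=
  exists h : X -> set (sect U),
    [/\ (forall y, U y -> is_prime (h y)),
        (forall P, is_prime P -> exists2 y, U y & h y = P),
        (forall y z, U y -> U z -> h y = h z -> y = z),
        (forall W : set X, W `<=` U ->
           (open W <-> exists E : set (sect U), W = [set y | U y /\ ~ (E `<=` h y)]))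
      & (forall (a : sect U) (D : opens X) (hD : D `<=` U),
           D = [set y | U y /\ ~ h y a] :> set X -> is_localization a (res hD))].

Record scheme := Scheme {
  scheme_space :> ringedSpace;
  stalk_local : forall x : scheme_space, is_local (stalk x);
  affine_cover : forall x : scheme_space,
    exists2 U : opens scheme_space, U x & affine U
}.

Section LocalRingAtPoint.
Variables (V : scheme) (x : V).

Definition scheme_stalk : Type := stalk x.

HB.instance Definition _ := GRing.ComPzRing.on scheme_stalk.

Lemma scheme_stalk_neq0 : (1 : scheme_stalk) != 0.
Proof. by apply/eqP; have [] := stalk_local x. Qed.

HB.instance Definition _ :=
  GRing.PzSemiRing_isNonZero.Build scheme_stalk scheme_stalk_neq0.

Definition local_ring_at : localRing :=
  @LocalRing scheme_stalk (stalk_local x).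

End LocalRingAtPoint.

Notation "''O_' x" := (local_ring_at x) (at level 8, x at level 2, format "''O_' x").

Section Smooth.
Variables (k : fieldType) (A : comPzRingType) (str : {rmorphism k -> A}).

Definition finite_type_alg : Prop :=
  exists s : seq A, forall S : set A,
    (forall c, S (str c)) -> (forall a, a \in s -> S a) ->
    (forall a b, S a -> S b -> S (a + b)) ->
    (forall a b, S a -> S b -> S (a * b)) -> S = setT.

(* Infinitesimal lifting along B -> C surjective with square-zero kernel. *)
Definition formally_smooth_alg : Prop :=
  forall (B C : comPzRingType) (strB : {rmorphism k -> B})
    (p : {rmorphism B -> C}) (f : {rmorphism A -> C}),
    (forall c, exists b, p b = c) ->
    (forall b b', p b = 0 -> p b' = 0 -> b * b' = 0) ->
    (forall c, f (str c) = p (strB c)) ->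
    exists g : {rmorphism A -> B},
      (forall a, p (g a) = f a) /\ (forall c, g (str c) = strB c).

(* Over a field, finite type and finite presentation agree. *)
Definition smooth_alg : Prop := finite_type_alg /\ formally_smooth_alg.

End Smooth.

(* A morphism V -> Spec k is a ring morphism from k to the global sections. *)
Definition smooth (k : fieldType) (V : scheme)
    (str : {rmorphism k -> sect (opensT V)}) : Prop :=
  forall x : V, exists U : opens V,
    [/\ U x, affine U &
      smooth_alg (res (@subsetT _ U : U `<=` opensT V) \o str)].

Record idealSheaf (X : ringedSpace) := IdealSheaf {
  isec :> forall U : opens X, set (sect U);
  isec_ideal : forall U, is_ideal (@isec U);
  isec_res : forall (U W : opens X) (h : W `<=` U) s, isec s -> isec (res h s);
  isec_local : forall (U : opens X) (s : sect U),
    (forall y, U y -> exists (W : opens X) (h : W `<=` U), W y /\ isec (res h s)) ->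
    isec s
}.

Section IdealSheaves.
Variable X : ringedSpace.
Implicit Type J : idealSheaf X.

Definition ideal_stalk J (x : X) : set (stalk x) :=
  [set a | exists (U : opens X) (Ux : U x) s, J U s /\ a = germ Ux s].

Definition zero_sec (U : opens X) : set (sect U) := [set 0].

Lemma zero_sec_ideal U : is_ideal (@zero_sec U).
Proof.
by rewrite /zero_sec; split=> //= [a b -> ->|a b ->]; rewrite ?addr0 ?mulr0.
Qed.

Lemma zero_sec_res (U W : opens X) (h : W `<=` U) s :
  zero_sec s -> zero_sec (res h s).
Proof. by rewrite /zero_sec /= => ->; rewrite rmorph0. Qed.

Lemma zero_sec_local (U : opens X) (s : sect U) :
  (forall y, U y -> exists (W : opens X) (h : W `<=` U), W y /\ zero_sec (res h s)) ->
  zero_sec s.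
Proof.
move=> sP; pose I := {W : opens X & {h : W `<=` U | res h s = 0}}.
apply: (@sect_sep X U I (fun i => tag i) (fun i => sval (tagged i))).
  move=> y /sP[W [h [Wy e]]]; by exists (existT _ W (exist _ h e)).
by move=> [W [h e]] /=; rewrite e rmorph0.
Qed.

Definition ideal_sheaf0 : idealSheaf X :=
  IdealSheaf zero_sec_ideal zero_sec_res zero_sec_local.

(* The sheaf associated with U |-> J(U)^m. *)
Definition exp_sec J (m : nat) (U : opens X) : set (sect U) :=
  [set s | forall y, U y -> exists (W : opens X) (h : W `<=` U),
     W y /\ ideal_exp (J W) m (res h s)].

Lemma exp_sec_ideal J m U : is_ideal (@exp_sec J m U).
Proof.
split=> /=.
- move=> y Uy; exists U, (fun _ h => h); split=> //.
  by rewrite rmorph0; case: (ideal_exp_ideal (J U) m).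
- move=> a b Ja Jb y Uy.
  have [W [h [Wy Wa]]] := Ja y Uy; have [Z [h' [Zy Zb]]] := Jb y Uy.
  have hW : opensI W Z `<=` W by move=> z [].
  have hZ : opensI W Z `<=` Z by move=> z [].
  exists (opensI W Z), (subset_trans hW h); split=> //; rewrite rmorphD.
  case: (ideal_exp_ideal (J (opensI W Z)) m) => _ D _; apply: D.
    rewrite -(res_comp h hW); apply: ideal_exp_morph Wa => c; exact: isec_res.
  rewrite (Prop_irrelevance (subset_trans hW h) (subset_trans hZ h')).
  by rewrite -(res_comp h' hZ); apply: ideal_exp_morph Zb => c; exact: isec_res.
- move=> a b Jb y Uy; have [W [h [Wy Wb]]] := Jb y Uy.
  exists W, h; split=> //; rewrite rmorphM.
  by case: (ideal_exp_ideal (J W) m) => _ _; apply.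
Qed.

Lemma exp_sec_res J m (U W : opens X) (h : W `<=` U) s :
  exp_sec J m s -> exp_sec J m (res h s).
Proof.
move=> Js y Wy; have [Z [h' [Zy Zs]]] := Js y (h y Wy).
have hW : opensI W Z `<=` W by move=> z [].
have hZ : opensI W Z `<=` Z by move=> z [].
exists (opensI W Z), hW; split=> //.
rewrite (res_comp h hW (subset_trans hZ h')) -(res_comp h' hZ).
by apply: ideal_exp_morph Zs => c; exact: isec_res.
Qed.

Lemma exp_sec_local J m (U : opens X) (s : sect U) :
  (forall y, U y -> exists (W : opens X) (h : W `<=` U), W y /\ exp_sec J m (res h s)) ->
  exp_sec J m s.
Proof.
move=> sP y Uy; have [W [h [Wy /(_ y Wy)[Z [h' [Zy Zs]]]]]] := sP y Uy.
exists Z, (subset_trans h' h); split=> //.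
by rewrite -(res_comp h h').
Qed.

Definition ideal_sheaf_exp J m : idealSheaf X :=
  IdealSheaf (@exp_sec_ideal J m) (@exp_sec_res J m) (@exp_sec_local J m).

End IdealSheaves.

Section ReesAlgebras.
Variable V : scheme.

(* A family G stands for the graded O_V-submodule (+)_n (G n) W^n of O_V[W]. *)
Implicit Type G : nat -> idealSheaf V.

Definition ideal_at (J : idealSheaf V) (x : V) : set 'O_x := @ideal_stalk V J x.
Arguments ideal_at : clear implicits.

Definition graded_at G (x : V) : set {poly 'O_x} :=
  [set p | forall n, ideal_at (G n) x p`_n].
Arguments graded_at : clear implicits.

(* R[f_1 W^(n_1), ..., f_s W^(n_s)] as an R-subalgebra of R[W]. *)
Definition weighted_alg (R : comNzRingType) (s : nat) (f : 'I_s -> R)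
    (n : 'I_s -> nat) : set {poly R} :=
  smallest
    [set S : set {poly R} |
      [/\ (forall c, S c%:P),
          (forall p q, S p -> S q -> S (p + q))
        & (forall p q, S p -> S q -> S (p * q))]]
    [set f i *: 'X^(n i) | i in setT].

(* The third clause is local finite generation as a sheaf of O_V-algebras:
   sections of a sheaf of algebras over U generate it if and only if their germs
   generate every stalk over U. *)
Definition is_rees_algebra G : Prop :=
  [/\ (forall U, G 0%N U = setT),
      (forall m n U a b, G m U a -> G n U b -> G (m + n)%N U (a * b))
    & (forall x, exists (U : opens V) (s : nat) (f : 'I_s -> sect U) (n : 'I_s -> nat),
        [/\ U x, (forall i, G (n i) U (f i))
          & forall y (Uy : U y),
              graded_at G y = weighted_alg (fun i => germ Uy (f i) : 'O_y) n])].

Definition Sing G : set V :=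
  [set x | forall n, (1 <= n)%N -> order_ge (ideal_at (G n) x) n].

(* The subalgebra O_V[(G N) W^N] of O_V[W], for 0 < N. *)
Definition rees_power G (N : nat) : nat -> idealSheaf V :=
  fun n => if (N %| n)%N then ideal_sheaf_exp (G N) (n %/ N) else ideal_sheaf0 V.

Definition initial_ideal G (x : V) : set (gr 'O_x) :=
  ideal_gen (\bigcup_(n in [set n | (1 <= n)%N]) initial_forms n (ideal_at (G n) x)).

End ReesAlgebras.

Arguments ideal_at [V] J x.
Arguments graded_at [V] G x.
Arguments initial_ideal [V] G x.

(* Main.v *)
(** Write R for the local ring at x and J_n for the stalk of I_n.  For (1), a
    form of degree mN in J_N^m is a combination of products of m initial forms
    in degree N.  For (2), R[f_1 W^n_1, ..., f_s W^n_s] has, in each positive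
    degree n, coefficients whose classes in M^n/M^(n+1) lie in the radical of
    the ideal generated by the In_(n_i)(f_i); and In_(n_i)(f_i)^(N/n_i) is the
    initial form of f_i^(N/n_i), an element of J_N. *)
Require Import Defs.
From HB Require Import structures.
From mathcomp Require Import all_boot all_algebra.
From mathcomp Require Import boolp classical_sets topology.

Import GRing.Theory.
Local Open Scope ring_scope.
Local Open Scope classical_set_scope.

Lemma radical_ideal (R : comPzRingType) (I : set R) :
  is_ideal I -> is_ideal (radical I).
Proof.
move=> iI; have [I0 _ IM] := iI; split.
- by exists 1%N; rewrite expr1.
- move=> a b [m Ia] [n Ib]; exists (m + n)%N; rewrite exprDn.
  apply: ideal_sum => // i; rewrite -mulr_natl; apply: (IM).
  have [ni|lt_in] := leqP n i.
    by rewrite -(subnK ni) exprD mulrA; apply: (IM).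
  have mi : (m <= m + n - i)%N by rewrite -addnBA ?leq_addr // ltnW.
  by rewrite mulrC -(subnK mi) exprD mulrA; apply: (IM).
- by move=> a b [n Ib]; exists n; rewrite exprMn; apply: (IM).
Qed.

Lemma radicalS (R : comPzRingType) (I J : set R) :
  I `<=` J -> radical I `<=` radical J.
Proof. by move=> IJ a [n Ia]; exists n; exact: IJ. Qed.

Lemma sub_radical (R : comPzRingType) (I : set R) : I `<=` radical I.
Proof. by move=> a Ia; exists 1%N; rewrite expr1. Qed.

Lemma radical_idem (R : comPzRingType) (I : set R) :
  radical (radical I) `<=` radical I.
Proof. by move=> a [m [n Ia]]; exists (m * n)%N; rewrite exprM. Qed.

Section InitialForms.
Variable R : localRing.
Local Notation M := (max_ideal R).

Lemma blowup_monomial (n : nat) (a : R) :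
  ideal_exp M n a -> exists p : blowup_ring R, blowup_val p = a *: 'X^n.
Proof.
move=> Ma; suff pP : a *: 'X^n \in @blowup_pred R by exists (BlowupRing pP).
apply/asboolP => m; rewrite coefZ coefXn; have [->|_] := eqVneq m n.
  by rewrite mulr1.
by rewrite mulr0; have [] := ideal_exp_ideal M m.
Qed.

Definition coefs_in (I : set (gr R)) (n : nat) : set R :=
  [set a | exists2 p : blowup_ring R,
     blowup_val p = a *: 'X^n & I (\pi_(gr R) p)%qT].

Lemma initial_forms_subP (I : set (gr R)) (n : nat) (J : set R) :
  J `<=` coefs_in I n -> initial_forms n J `<=` I.
Proof.
move=> JI _ [p [a Ja pE] <-]; have [q qE Iq] := JI a Ja.
by rewrite (_ : p = q) //; apply: val_inj; rewrite /= pE qE.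
Qed.

Lemma sub_coefs_in (I : set (gr R)) (n : nat) (J : set R) :
  order_ge J n -> initial_forms n J `<=` I -> J `<=` coefs_in I n.
Proof.
move=> JM JI a Ja; have [p pE] := blowup_monomial n a (JM a Ja).
by exists p => //; apply: JI; exists p => //; exists a.
Qed.

Lemma coefs_inM (I : set (gr R)) (m n : nat) (a b : R) : is_ideal I ->
  coefs_in I m a -> ideal_exp M n b -> coefs_in I (m + n) (a * b).
Proof.
move=> [_ _ IM] [p pE Ip] /blowup_monomial[q qE]; exists (p * q).
  by rewrite [LHS](_ : _ = blowup_val p * blowup_val q) // pE qE exprD
    -scalerAl -scalerAr scalerA.
by rewrite rmorphM mulrC; apply: IM.
Qed.

Lemma coefs_in_ideal (I : set (gr R)) (n : nat) :
  is_ideal I -> is_ideal (coefs_in I n).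
Proof.
move=> iI; have [I0 ID _] := iI; split.
- by exists 0; rewrite ?scale0r ?rmorph0.
- move=> a b [p pE Ip] [q qE Iq]; exists (p + q).
    by rewrite [LHS](_ : _ = blowup_val p + blowup_val q) // pE qE scalerDl.
  by rewrite rmorphD; apply: ID.
- by move=> a b Ib; rewrite mulrC -[n]addn0; apply: coefs_inM.
Qed.

Lemma initial_forms_exp (J : set R) (N m : nat) : order_ge J N ->
  initial_forms (m.+1 * N) (ideal_exp J m.+1) `<=`
    ideal_gen (initial_forms N J).
Proof.
move=> JM; apply: initial_forms_subP; set I := ideal_gen _.
have iI : is_ideal I by exact: ideal_gen_ideal.
apply: ideal_gen_min; first exact: coefs_in_ideal.
have expM : forall l, ideal_exp J l `<=` ideal_exp M (l * N).
  elim=> [//|l IHl]; apply: ideal_gen_min; first exact: ideal_exp_ideal.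
  by move=> _ [a Ja [b Jb <-]]; rewrite mulSn; apply: ideal_expM; [exact: JM|exact: IHl].
move=> _ [a Ja [b Jb <-]]; rewrite mulSn; apply: coefs_inM => //; last exact: expM.
by apply: sub_coefs_in Ja => //; exact: ideal_gen_sub.
Qed.

Lemma weighted_alg_coefs (I : set (gr R)) (s : nat) (f : 'I_s -> R)
    (n : 'I_s -> nat) : is_ideal I ->
  (forall i, ideal_exp M (n i) (f i)) -> (forall i, coefs_in I (n i) (f i)) ->
  forall p, weighted_alg f n p -> forall m, (1 <= m)%N -> coefs_in I m p`_m.
Proof.
move=> iI Mf If.
pose T := [set p : {poly R} | forall m,
  ideal_exp M m p`_m /\ ((1 <= m)%N -> coefs_in I m p`_m)].
suff sT : weighted_alg f n `<=` T by move=> p /sT Tp m; case: (Tp m).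
have iC m := coefs_in_ideal I m iI.
have iM m := ideal_exp_ideal M m.
have C0 m : coefs_in I m 0 by have [] := iC m.
have M0 m : ideal_exp M m 0 by have [] := iM m.
apply: smallest_sub; last first.
  move=> _ [i _ <-] m; rewrite coefZ coefXn; have [->|_] := eqVneq m (n i).
    by rewrite mulr1.
  by rewrite mulr0.
split.
- by move=> c [|m]; rewrite coefC.
- move=> p q Tp Tq m; have [Mp Ip] := Tp m; have [Mq Iq] := Tq m.
  have [_ MD _] := iM m; have [_ CD _] := iC m.
  by rewrite coefD; split=> [|m1]; [exact: MD|apply: CD; [exact: Ip|exact: Iq]].
- move=> p q Tp Tq m; rewrite coefM; split=> [|m1].
    apply: (ideal_sum _ (iM m)) => i; have im : (i <= m)%N by rewrite -ltnS.
    rewrite -[X in ideal_exp _ X](subnKC im).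
    by apply: ideal_expM; [case: (Tp i)|case: (Tq (m - i)%N)].
  apply: (ideal_sum _ (iC m)) => i; have im : (i <= m)%N by rewrite -ltnS.
  have [Mp Ip] := Tp i; have [Mq Iq] := Tq (m - i)%N.
  have [i0|i1] := posnP i.
    rewrite mulrC -[X in coefs_in _ X](subnK im); apply: coefs_inM => //.
    by apply: Iq; rewrite i0 subn0.
  by rewrite -[X in coefs_in _ X](subnKC im); apply: coefs_inM => //; exact: Ip.
Qed.

Lemma weighted_algX (s : nat) (f : 'I_s -> R) (n : 'I_s -> nat) i d :
  weighted_alg f n ((f i ^+ d) *: 'X^(n i * d)).
Proof.
move=> S [[SC _ SM] Sf]; rewrite exprM -exprZn.
by elim: d => [|d IHd]; [exact: (SC 1)|rewrite exprS; apply: SM => //; apply: Sf; exists i].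
Qed.

Lemma weighted_alg_initial (J : nat -> set R) (s : nat) (f : 'I_s -> R)
    (n : 'I_s -> nat) (N : nat) :
  (forall m, (1 <= m)%N -> order_ge (J m) m) ->
  (forall i, (1 <= n i)%N) -> (forall i, (n i %| N)%N) ->
  [set p : {poly R} | forall m, J m p`_m] = weighted_alg f n ->
  forall m, (1 <= m)%N ->
    initial_forms m (J m) `<=` radical (ideal_gen (initial_forms N (J N))).
Proof.
move=> JM n1 nN JE m m1; apply: initial_forms_subP; set I := radical _.
have iI : is_ideal I by apply: radical_ideal; exact: ideal_gen_ideal.
have JX i d : J (n i * d)%N (f i ^+ d).
  have : weighted_alg f n ((f i ^+ d) *: 'X^(n i * d)) by exact: weighted_algX.
  by rewrite -JE => /(_ (n i * d)%N); rewrite coefZ coefXn eqxx mulr1.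
have Mf i : ideal_exp M (n i) (f i).
  by apply: (JM (n i)) => //; move: (JX i 1%N); rewrite muln1 expr1.
have J0 l : J l 0.
  have : weighted_alg f n 0 by move=> S [[SC _ _] _]; exact: (SC 0).
  by rewrite -JE => /(_ l); rewrite coef0.
move=> a Ja; have -> : a = (a *: 'X^m : {poly R})`_m.
  by rewrite coefZ coefXn eqxx mulr1.
apply: (weighted_alg_coefs I s f n) => //; last first.
  rewrite -JE => l; rewrite coefZ coefXn; have [->|_] := eqVneq l m.
    by rewrite mulr1.
  by rewrite mulr0.
move=> i; have [p pE] := blowup_monomial (n i) (f i) (Mf i); exists p => //.
exists (N %/ n i)%N; rewrite -rmorphXn; apply: ideal_gen_sub.
have niN : (n i * (N %/ n i) = N)%N by rewrite mulnC divnK.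
exists (p ^+ (N %/ n i)) => //; exists (f i ^+ (N %/ n i)).
  by rewrite -[X in J X]niN; exact: JX.
rewrite -{3}niN exprM -exprZn -pE.
by elim: (N %/ n i)%N => [//|d IHd]; rewrite !exprS -IHd.
Qed.

End InitialForms.

Section IdealStalks.
Variables (X : ringedSpace) (x : X).

Lemma germ_additive (U : opens X) (Ux : U x) : zmod_morphism (germ Ux).
Proof.
move=> a b; rewrite germD; congr (_ + _).
by apply/eqP; rewrite -addr_eq0 -germD addNr germ0.
Qed.

Lemma germ_multiplicative (U : opens X) (Ux : U x) :
  monoid_morphism (germ Ux).
Proof. by split=> [|a b]; rewrite (germ1, germM). Qed.

HB.instance Definition _ (U : opens X) (Ux : U x) :=
  GRing.isZmodMorphism.Build (sect U) (stalk x) (germ Ux)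
    (germ_additive U Ux).
HB.instance Definition _ (U : opens X) (Ux : U x) :=
  GRing.isMonoidMorphism.Build (sect U) (stalk x) (germ Ux)
    (germ_multiplicative U Ux).

Lemma ideal_stalk0 : @ideal_stalk X (ideal_sheaf0 X) x `<=` [set 0].
Proof. by move=> _ [U [Ux [s [-> ->]]]]; rewrite germ0. Qed.

Lemma ideal_stalk_exp (J : idealSheaf X) (m : nat) :
  @ideal_stalk X (ideal_sheaf_exp J m) x `<=` ideal_exp (@ideal_stalk X J x) m.
Proof.
move=> _ [U [Ux [s [/(_ x Ux)[W [h [Wx Js]]] ->]]]].
rewrite -(germ_res Ux Wx h).
by apply: (ideal_exp_morph (f := germ Wx)) Js => c Jc; exists W, Wx, c.
Qed.

Lemma ideal_stalk_exp1 (J : idealSheaf X) :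
  @ideal_stalk X J x `<=` @ideal_stalk X (ideal_sheaf_exp J 1) x.
Proof.
move=> _ [U [Ux [s [Js ->]]]]; exists U, Ux, s; split=> // y Uy.
exists U, (fun _ h => h); split=> //; rewrite res_id.
by apply: ideal_gen_sub; exists s => //; exists 1; rewrite ?mulr1.
Qed.

End IdealStalks.

Theorem lemma5p4 (k : fieldType) (V : scheme)
    (str : {rmorphism k -> sect (opensT V)}) (smoothV : smooth str)
    (G : nat -> idealSheaf V) (reesG : is_rees_algebra G)
    (x : V) (xSing : Sing G x)
    (s : nat) (f : 'I_s -> 'O_x) (n : 'I_s -> nat)
    (n_ge1 : forall i, (1 <= n i)%N)
    (genG : graded_at G x = weighted_alg f n)
    (N : nat) (N_gt0 : (0 < N)%N) (n_dvdN : forall i, (n i %| N)%N) :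
  initial_ideal (rees_power G N) x =
    ideal_gen (initial_forms N (ideal_at (G N) x)) /\
  (radical (initial_ideal (rees_power G N) x) =
     radical (ideal_gen (initial_forms N (ideal_at (G N) x))) /\
   radical (ideal_gen (initial_forms N (ideal_at (G N) x))) =
     radical (initial_ideal G x)).
Proof.
set J := fun m => ideal_at (G m) x; rewrite -/(J N).
set I := ideal_gen (initial_forms N (J N)).
have iI : is_ideal I by exact: ideal_gen_ideal.
have JM m : (1 <= m)%N -> order_ge (J m) m by exact: xSing.
have powE : initial_ideal (rees_power G N) x = I.
  rewrite eqEsubset; split; apply: ideal_gen_min => //.
  - move=> g [m m1]; rewrite /rees_power; case: ifPn => [|_].
      move=> /dvdnP[[|d] mE]; first by rewrite mE in m1.
      rewrite mE mulnK // => -[p [a Ja pE] <-].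
      apply: (initial_forms_exp _ (J N) N d (JM N N_gt0)).
      by exists p => //; exists a => //; exact: ideal_stalk_exp Ja.
    apply: initial_forms_subP => a /ideal_stalk0 ->.
    by have [] := coefs_in_ideal _ _ m iI.
  - exact: ideal_gen_ideal.
  - move=> _ [p [a Ja pE] <-]; apply: ideal_gen_sub; exists N => //.
    exists p => //; exists a => //.
    by rewrite /rees_power dvdnn divnn N_gt0; exact: ideal_stalk_exp1.
rewrite powE; split=> //; split=> //.
rewrite eqEsubset; split.
  apply: radicalS; apply: ideal_gen_min; first exact: ideal_gen_ideal.
  by move=> g Jg; apply: ideal_gen_sub; exists N.
apply: subset_trans (radical_idem _ _); apply: radicalS.
apply: ideal_gen_min; first exact: radical_ideal.
move=> g [m m1]; exact: (weighted_alg_initial _ J s f n N JM n_ge1 n_dvdN genG).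
Qed.
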